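(* An abelian group $C$ is cotorsion if and only if it is isomorphic to a group of the form $$D\,\oplus\,\prod\nolimits_p C_p,$$ where the product is taken over all the prime numbers $p$, $D$ is a divisible group, and for each $p$ the group $C_p$ is a $p$-contramodule abelian group. The groups $D$ and $C_p$ are uniquely determined (up to isomorphism) by the group $C$.
   Context: An abelian group $C$ is cotorsion if $\operatorname{Ext}^1_{\mathbb Z}(F,C)=0$ for every flat (equivalently, torsion-free) abelian group $F$. For a prime number $p$, an abelian group $C$ is a $p$-contramodule if $\operatorname{Hom}_{\mathbb Z}(\mathbb Z[p^{-1}],C)=0=\operatorname{Ext}^1_{\mathbb Z}(\mathbb Z[p^{-1}],C)$. *)

(* Defs.v *)
From HB Require Import structures.
From mathcomp Require Import all_boot all_order all_algebra.
From mathcomp Require Import boolp.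
Set Implicit Arguments.
Unset Strict Implicit.
Unset Printing Implicit Defensive.
Import GRing.Theory Num.Theory.
Local Open Scope ring_scope.

Definition zmod_iso (A B : zmodType) : Prop :=
  exists f : {additive A -> B}, bijective f.

Definition divisible (D : zmodType) : Prop :=
  forall (n : nat) (x : D), (0 < n)%N -> exists y : D, y *+ n = x.

(* Tensor products over Z, characterised by their universal property.         *)

Definition biadditive (A B V : zmodType) (t : A -> B -> V) : Prop :=
  (forall a : A, zmod_morphism (t a)) /\
  (forall b : B, zmod_morphism (fun a => t a b)).

Definition is_tensor (A B T : zmodType) (t : A -> B -> T) : Prop :=
  biadditive t /\
  forall (V : zmodType) (g : A -> B -> V), biadditive g ->
    exists h : {additive T -> V},
      (forall a b, h (t a b) = g a b) /\
      (forall h' : {additive T -> V},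
         (forall a b, h' (t a b) = g a b) -> forall x, h' x = h x).

(* In flat, h is the map F (x) i : F (x) A -> F (x) B.                        *)
Definition flat (F : zmodType) : Prop :=
  forall (A B : zmodType) (i : {additive A -> B}), injective i ->
  forall (FA FB : zmodType) (tA : F -> A -> FA) (tB : F -> B -> FB),
    is_tensor tA -> is_tensor tB ->
  forall h : {additive FA -> FB},
    (forall x a, h (tA x a) = tB x (i a)) -> injective h.

(* Ext^1_Z(F, C) in the sense of Yoneda: short exact sequences                *)
(* 0 -> C -> E -> F -> 0 up to equivalence, the zero class being that of the  *)
(* split extension C (+) F.                                                   *)

Record extension (F C : zmodType) := Extension {
  ext_mid : zmodType;
  ext_inj : {additive C -> ext_mid};
  ext_proj : {additive ext_mid -> F};
  ext_injP : injective ext_inj;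
  ext_projP : forall x : F, exists e : ext_mid, ext_proj e = x;
  ext_exactP : forall e : ext_mid,
    ext_proj e = 0 <-> exists c : C, ext_inj c = e
}.

Definition ext_equiv (F C : zmodType) (E E' : extension F C) : Prop :=
  exists phi : {additive ext_mid E -> ext_mid E'},
    [/\ bijective phi,
        forall c : C, phi (ext_inj E c) = ext_inj E' c &
        forall e : ext_mid E, ext_proj E' (phi e) = ext_proj E e].

Section SplitExtension.
Variables F C : zmodType.

Definition split_inj (c : C) : (C * F)%type := (c, 0).
Definition split_proj (e : (C * F)%type) : F := e.2.

Fact split_inj_additive : zmod_morphism split_inj.
Proof. by move=> a b; congr pair; rewrite subr0. Qed.
HB.instance Definition _ :=
  Algebra.isZmodMorphism.Build C (C * F)%type split_inj split_inj_additive.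

Fact split_proj_additive : zmod_morphism split_proj.
Proof. by []. Qed.
HB.instance Definition _ :=
  Algebra.isZmodMorphism.Build (C * F)%type F split_proj split_proj_additive.

Fact split_injP : injective split_inj.
Proof. by move=> a b []. Qed.

Fact split_projP (x : F) : exists e : (C * F)%type, split_proj e = x.
Proof. by exists (0, x). Qed.

Fact split_exactP (e : (C * F)%type) :
  split_proj e = 0 <-> exists c : C, split_inj c = e.
Proof.
case: e => c x; split=> [x0|[c' [_ <-]] //].
by exists c; congr pair; rewrite -x0.
Qed.

Definition split_extension : extension F C :=
  Extension split_injP split_projP split_exactP.

End SplitExtension.

Definition Ext1_eq0 (F C : zmodType) : Prop :=
  forall E : extension F C, ext_equiv E (split_extension F C).

Definition Hom_eq0 (A C : zmodType) : Prop :=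
  forall (f : {additive A -> C}) (a : A), f a = 0.

Definition cotorsion (C : zmodType) : Prop :=
  forall F : zmodType, flat F -> Ext1_eq0 F C.

Definition primes_type := {p : nat | prime p}.

(* The additive group of Z[1/p], as a subgroup of the rationals.              *)
Definition Zinv_pred (p : primes_type) : {pred rat} :=
  fun x : rat => `[< exists (a : int) (n : nat), x = a%:~R / (val p)%:R ^+ n >].

Fact Zinv_zmod_closed (p : primes_type) : zmod_closed (Zinv_pred p).
Proof.
have p0 : (val p)%:R != 0 :> rat.
  by rewrite pnatr_eq0 -lt0n; apply/prime_gt0/(valP p).
split; first by apply/asboolP; exists 0, 0%N; rewrite mul0r.
move=> x y /asboolP[a [n ->]] /asboolP[b [m ->]]; apply/asboolP.
exists (a * (val p)%:R ^+ m - b * (val p)%:R ^+ n), (n + m)%N.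
rewrite rmorphB !rmorphM !rmorphXn !rmorph_nat mulrBl exprD invfM /=.
congr (_ - _); first by rewrite mulrACA divff ?mulr1 // expf_neq0.
by rewrite [X in _ = _ * _ * X]mulrC mulrACA divff ?mulr1 // expf_neq0.
Qed.
HB.instance Definition _ (p : primes_type) :=
  Algebra.isZmodClosed.Build rat (Zinv_pred p) (Zinv_zmod_closed p).

Definition Zinv (p : primes_type) := {x : rat | x \in Zinv_pred p}.
HB.instance Definition _ (p : primes_type) := SubChoice.on (Zinv p).
HB.instance Definition _ (p : primes_type) :=
  [SubChoice_isSubZmodule of Zinv p by <:].

Definition contramodule (p : primes_type) (C : zmodType) : Prop :=
  Hom_eq0 (Zinv p) C /\ Ext1_eq0 (Zinv p) C.

Definition zprod (I : Type) (C : I -> zmodType) := forall i : I, C i.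

Section ProductGroup.
Variables (I : Type) (C : I -> zmodType).
Implicit Types f g : zprod C.

HB.instance Definition _ := gen_eqMixin (zprod C).
HB.instance Definition _ := gen_choiceMixin (zprod C).

Definition zprod_zero : zprod C := fun i => 0.
Definition zprod_opp f : zprod C := fun i => - f i.
Definition zprod_add f g : zprod C := fun i => f i + g i.

Fact zprod_addA : associative zprod_add.
Proof. by move=> f g h; apply: functional_extensionality_dep => i; exact: addrA. Qed.
Fact zprod_addC : commutative zprod_add.
Proof. by move=> f g; apply: functional_extensionality_dep => i; exact: addrC. Qed.
Fact zprod_add0 : left_id zprod_zero zprod_add.
Proof. by move=> f; apply: functional_extensionality_dep => i; exact: add0r. Qed.
Fact zprod_addN : left_inverse zprod_zero zprod_opp zprod_add.
Proof. by move=> f; apply: functional_extensionality_dep => i; exact: addNr. Qed.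

HB.instance Definition _ := Algebra.isZmodule.Build (zprod C)
  zprod_addA zprod_addC zprod_add0 zprod_addN.

End ProductGroup.

Definition cotorsion_decomposition (C D : zmodType)
    (Cp : primes_type -> zmodType) : Prop :=
  [/\ divisible D,
      forall p : primes_type, contramodule p (Cp p) &
      zmod_iso C (D * zprod Cp)%type].

(* Main.v *)
(** The relation [x n = a n + m n x (n+1)], to be solved in [C] for given [a],
    encodes [Ext^1] of the rank one group generated by [g n = m n g (n+1)], and
    its homogeneous version encodes [Hom].  Thus [C] is a [p]-contramodule iff
    the system with [m = p] is always uniquely solvable, and a cotorsion [C]
    solves the systems of [Z[1/p]] and of [Q].

    If [D_p] denotes the group of elements of [C] having an infinite sequence of
    successive [p]-th roots, then [C / D_p] is a [p]-contramodule, on which every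
    other prime acts invertibly; hence the image of [C] in [P = prod C / D_p]
    satisfies [P = im C + n P] for all [n > 0].  Solving the system of [Q] in [C],
    and using [Hom(Q, P) = 0], shows that [C -> P] is onto.  Its kernel, the
    intersection [D] of the [D_p], is divisible, so the sequence splits.  In any
    decomposition, [C_p] is [C / D_p] and [D] is this intersection, whence
    uniqueness.

    Conversely a map to a [p]-contramodule extends along any embedding with
    [p]-torsion-free cokernel: in a maximal extension with [p]-pure domain [S] of
    the ambient group [E], one has [E = S + p E], since another element could be
    adjoined freely otherwise, and then unique solvability determines the values
    on all of [E]. *)

From HB Require Import structures.
Require Import Defs.
From mathcomp Require Import all_boot all_order all_algebra.
From mathcomp Require Import generic_quotient ring_quotient.
From mathcomp Require Import boolp classical_sets.
From mathcomp Require Import ring.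
Set Implicit Arguments.
Unset Strict Implicit.
Unset Printing Implicit Defensive.
Import GRing.Theory Num.Theory.
Local Open Scope quotient_scope.
Local Open Scope ring_scope.

(** * Subgroups, quotients and graphs of homomorphisms *)

Definition is_subgroup (V : zmodType) (S : V -> Prop) : Prop :=
  S 0 /\ forall x y, S x -> S y -> S (x - y).

Section IsSubgroupTheory.
Variables (V : zmodType) (S : V -> Prop) (subgroupS : is_subgroup S).

Lemma subgroup0 : S 0. Proof. by case: subgroupS. Qed.

Lemma subgroupB x y : S x -> S y -> S (x - y).
Proof. by case: subgroupS => _; apply. Qed.

Lemma subgroupN x : S x -> S (- x).
Proof. by move=> Sx; rewrite -sub0r; apply: subgroupB => //; exact: subgroup0. Qed.

Lemma subgroupD x y : S x -> S y -> S (x + y).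
Proof.
by move=> Sx Sy; rewrite -[y]opprK; apply: subgroupB => //; exact: subgroupN.
Qed.

Lemma subgroupMn x n : S x -> S (x *+ n).
Proof.
move=> Sx; elim: n => [|n IHn]; first exact: subgroup0.
by rewrite mulrS; apply: subgroupD.
Qed.

Lemma subgroupMz x z : S x -> S (x *~ z).
Proof.
by case: z => n Sx; [|apply: subgroupN]; apply: subgroupMn.
Qed.
End IsSubgroupTheory.

Record subgroup (V : zmodType) := Subgroup {
  subgroup_carrier : V -> Prop;
  subgroup_carrierP : is_subgroup subgroup_carrier
}.

Definition subgroup_pred (V : zmodType) (G : subgroup V) : {pred V} :=
  fun x => `[< subgroup_carrier G x >].

Fact subgroup_pred_closed (V : zmodType) (G : subgroup V) :
  zmod_closed (subgroup_pred G).
Proof.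
split=> [|x y /asboolP Gx /asboolP Gy]; apply/asboolP.
  exact: subgroup0 (subgroup_carrierP G).
exact: subgroupB (subgroup_carrierP G) _ _ Gx Gy.
Qed.
HB.instance Definition _ (V : zmodType) (G : subgroup V) :=
  GRing.isZmodClosed.Build V (subgroup_pred G) (subgroup_pred_closed G).

Definition subgroup_sub (V : zmodType) (G : subgroup V) :=
  {x : V | x \in subgroup_pred G}.
HB.instance Definition _ (V : zmodType) (G : subgroup V) :=
  SubChoice.on (subgroup_sub G).
HB.instance Definition _ (V : zmodType) (G : subgroup V) :=
  [SubChoice_isSubZmodule of subgroup_sub G by <:].

Lemma subgroup_exists (V : zmodType) (S : V -> Prop) : is_subgroup S ->
  exists (U : zmodType) (u : {additive U -> V}),
    injective u /\ forall x, S x <-> exists y, u y = x.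
Proof.
move=> SP; pose G := Subgroup SP.
exists (subgroup_sub G), (val : {additive subgroup_sub G -> V}).
split=> [|x]; first exact: val_inj.
split=> [Sx|[[y Gy] /= <-]]; last exact/asboolP.
by exists (exist _ x (asboolT Sx)).
Qed.

Lemma quotient_exists (V : zmodType) (S : V -> Prop) : is_subgroup S ->
  exists (Q : zmodType) (pi : {additive V -> Q}),
    (forall y, exists x, pi x = y) /\ forall x, pi x = 0 <-> S x.
Proof.
move=> SP; pose G : zmodClosed V := subgroup_pred (Subgroup SP).
exists (Quotient.quot G),
  (\pi_(Quotient.quot G) : {additive V -> Quotient.quot G}).
split=> [y|x]; first by exists (repr y); exact: reprK.
have := Quotient.idealrBE G x 0; rewrite subr0 => xG.
have <- : \pi_(Quotient.quot G) 0 = 0 by rewrite raddf0.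
split=> [/eqP|Sx].
  by rewrite -xG => /asboolP.
by apply/eqP; rewrite -xG; exact/asboolP.
Qed.

(** Homomorphisms are built from relations here: additivity reduces to the graph being a subgroup,
    and subtracting two pairs over the same point shows that the value is unique. *)
Lemma graph_hom (A B : zmodType) (G : A * B -> Prop) : is_subgroup G ->
  (forall b, G (0, b) -> b = 0) -> (forall a, exists b, G (a, b)) ->
  exists f : {additive A -> B}, forall a b, G (a, b) -> f a = b.
Proof.
move=> sgG funG /choice[f fP].
have fE a b : G (a, b) -> f a = b.
  move=> Gab; apply/eqP; rewrite -subr_eq0; apply/eqP/funG.
  by have := subgroupB sgG (fP a) Gab; rewrite /GRing.add /= /add_pair /= subrr.
have fB : zmod_morphism f.
  by move=> a a'; apply: fE; exact: subgroupB sgG _ _ (fP a) (fP a').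
pose fM := GRing.isZmodMorphism.Build A B f fB.
pose F : {additive A -> B} := HB.pack f fM.
by exists F.
Qed.

Lemma bij_zmod_iso (A B : zmodType) (f : {additive A -> B}) :
  (forall a, f a = 0 -> a = 0) -> (forall b, exists a, f a = b) -> zmod_iso A B.
Proof.
move=> finj /choice[g gK]; exists f, g => // a.
by apply/eqP; rewrite -subr_eq0; apply/eqP/finj; rewrite raddfB gK subrr.
Qed.

Lemma zmod_isoP (A B : zmodType) : zmod_iso A B ->
  exists (f : {additive A -> B}) (g : {additive B -> A}), cancel f g /\ cancel g f.
Proof.
move=> [f [g fK gK]].
pose gM := GRing.isZmodMorphism.Build B A g (can2_zmod_morphism fK gK).
pose G : {additive B -> A} := HB.pack g gM.
by exists f, G.
Qed.

Lemma dep_choice (I : Type) (T : I -> Type) (P : forall i, T i -> Prop) :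
  (forall i, exists x, P i x) -> exists f : forall i, T i, forall i, P i (f i).
Proof. by move=> H; exists (fun i => sval (cid (H i))) => i; exact: svalP. Qed.

Lemma surj_same_ker_iso (V A B : zmodType)
    (f : {additive V -> A}) (g : {additive V -> B}) :
  (forall a, exists x, f x = a) -> (forall b, exists x, g x = b) ->
  (forall x, f x = 0 <-> g x = 0) -> zmod_iso A B.
Proof.
move=> fS gS fg.
pose G (ab : A * B) := exists x, f x = ab.1 /\ g x = ab.2.
have sgG : is_subgroup G.
  split; first by exists 0; rewrite !raddf0.
  move=> [a b] [a' b'] [x /= [<- <-]] [y /= [<- <-]].
  by exists (x - y); rewrite !raddfB.
have [||h hE] := @graph_hom _ _ _ sgG.
- by move=> b [x [/fg x0 /= <-]].
- by move=> a; have [x <-] := fS a; exists (g x), x.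
have hg x : h (f x) = g x by apply: hE; exists x.
apply: (@bij_zmod_iso _ _ h) => [a|b].
  by have [x <-] := fS a; rewrite hg => /fg.
by have [x <-] := gS b; exists (f x).
Qed.

Lemma inj_same_im_iso (V A B : zmodType)
    (f : {additive A -> V}) (g : {additive B -> V}) :
  injective f -> injective g ->
  (forall x, (exists a, f a = x) <-> exists b, g b = x) -> zmod_iso A B.
Proof.
move=> fI gI fg.
pose G (ab : A * B) := f ab.1 = g ab.2.
have sgG : is_subgroup G.
  split; first by rewrite /G !raddf0.
  by move=> x y; rewrite /G !raddfB => -> ->.
have [||h hE] := @graph_hom _ _ _ sgG.
- by move=> b; rewrite /G /= raddf0 => gb0; apply: gI; rewrite raddf0.
- by move=> a; have [|b bE] := (fg (f a)).1; [exists a | exists b].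
apply: (@bij_zmod_iso _ _ h) => [a ha0|b].
  have [|b bE] := (fg (f a)).1; first by exists a.
  have hb : h a = b by exact: hE.
  by apply: fI; rewrite -bE -hb ha0 !raddf0.
have [|a aE] := (fg (g b)).2; first by exists b.
by exists a; exact: hE.
Qed.

(** The pair formed by [r] and the projection is bijective: the kernel of the projection is the
    image of [C], where [r] inverts the inclusion. *)
Lemma retract_split (F C : zmodType) (E : extension F C)
    (r : {additive ext_mid E -> C}) :
  (forall c, r (ext_inj E c) = c) -> ext_equiv E (split_extension F C).
Proof.
move=> rK.
pose phi (e : ext_mid E) : (C * F)%type := (r e, ext_proj E e).
have phiB : zmod_morphism phi by move=> x y; rewrite /phi !raddfB.
pose phiM := GRing.isZmodMorphism.Build _ _ phi phiB.
pose Phi : {additive ext_mid E -> (C * F)%type} := HB.pack phi phiM.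
have projK c : ext_proj E (ext_inj E c) = 0 by apply/ext_exactP; exists c.
have phi_inj e : phi e = 0 -> e = 0.
  by case=> re0 /ext_exactP[c cE]; move: re0; rewrite -cE rK => ->; rewrite raddf0.
have phi_surj x : exists e, phi e = x.
  case: x => c x; have [e eE] := ext_projP E x.
  exists (e + ext_inj E (c - r e)).
  congr pair; last by rewrite raddfD projK eE addr0.
  by rewrite raddfD rK addrC subrK.
have [psi psiK] := choice phi_surj.
exists Phi; split=> //; last by move=> c; rewrite /= /phi rK projK.
exists psi => // e; apply/eqP; rewrite -subr_eq0; apply/eqP/phi_inj.
by rewrite phiB psiK subrr.
Qed.

Lemma split_retract (F C : zmodType) (E : extension F C) :
  ext_equiv E (split_extension F C) ->
  exists r : {additive ext_mid E -> C}, forall c, r (ext_inj E c) = c.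
Proof.
move=> [phi [_ phiC _]]; exists (fst \o phi : {additive _ -> _}) => c.
by rewrite /= phiC.
Qed.

(** * Extending homomorphisms by Zorn's lemma *)

(** Only the initial term is required to vanish; for constant [m], shifting the sequence gives the
    other terms. *)
Definition tower_trivial (m : nat -> nat) (C : zmodType) : Prop :=
  forall x : nat -> C, (forall n, x n = x n.+1 *+ m n) -> x 0%N = 0.

Definition tower_solvable (m : nat -> nat) (C : zmodType) : Prop :=
  forall a : nat -> C, exists x : nat -> C, forall n, x n = a n + x n.+1 *+ m n.

Definition functional_graph (A B : zmodType) (G : A * B -> Prop) : Prop :=
  is_subgroup G /\ forall b, G (0, b) -> b = 0.

Definition dom (A B : zmodType) (G : A * B -> Prop) (a : A) : Prop :=
  exists b, G (a, b).

(** [Pi] selects the multipliers: the empty choice makes purity vacuous, as needed for divisible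
    targets, and [eq p] gives [p]-purity. *)
Definition pure (Pi : nat -> Prop) (A : zmodType) (S : A -> Prop) : Prop :=
  forall p a, Pi p -> S (a *+ p) -> S a.

Lemma pair_mulrz (A B : zmodType) (a : A) (b : B) z :
  (a, b) *~ z = (a *~ z, b *~ z).
Proof. by rewrite [LHS]surjective_pairing (raddfMz fst) (raddfMz snd). Qed.

Lemma dom_subgroup (A B : zmodType) (G : A * B -> Prop) :
  is_subgroup G -> is_subgroup (dom G).
Proof.
move=> sgG; split; first by exists 0; exact: subgroup0 sgG.
by move=> a a' [b Gb] [b' Gb']; exists (b - b'); exact: subgroupB sgG _ _ Gb Gb'.
Qed.

Lemma maximal_graph (Pi : nat -> Prop) (A B : zmodType) (G0 : A * B -> Prop) :
  functional_graph G0 -> pure Pi (dom G0) ->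
  exists G : A * B -> Prop,
    [/\ functional_graph G, pure Pi (dom G), (forall x, G0 x -> G x) &
        forall G', functional_graph G' -> pure Pi (dom G') ->
          (forall x, G x -> G' x) -> forall x, G' x -> G x].
Proof.
move=> fG0 pG0.
pose good (G : A * B -> Prop) :=
  [/\ functional_graph G, pure Pi (dom G) & forall x, G0 x -> G x].
pose P : set (set (A * B)) := fun G => G = set0 \/ good G.
have [F FP Ftot|G [PG maxG]] := @Zorn_bigcup _ P.
  have [[G [FG goodG]]|noG] := pselect (exists G, F G /\ good G); last first.
    left; apply/seteqP; split=> // x [G FG Gx].
    by have [G0e|gG] := FP _ FG; [rewrite G0e in Gx | case: noG; exists G].
  have pick x : (\bigcup_(X in F) X)%classic x -> exists H, [/\ F H, good H & H x].
    move=> [H FH Hx]; exists H; split=> //.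
    by have [H0|//] := FP _ FH; rewrite H0 in Hx.
  right; split.
  - split.
      split; first by exists G => //; have [[sgG _] _ _] := goodG; exact: subgroup0 sgG.
      move=> x y /pick[H [FH gH Hx]] /pick[K [FK gK Ky]].
      have [HK|KH] := Ftot _ _ FH FK.
        exists K => //; have [[sg _] _ _] := gK.
        by apply: subgroupB sg _ _ _ _ => //; exact: HK.
      exists H => //; have [[sg _] _ _] := gH.
      by apply: subgroupB sg _ _ _ _ => //; exact: KH.
    by move=> b /pick[H [_ [[_ fH] _ _] Hb]]; exact: fH.
  - move=> p a Pip [b /pick[H [FH [_ pH _] Hb]]].
    by have [|c Hc] := pH p a Pip; [exists b | exists c, H].
  - by move=> x G0x; exists G => //; have [_ _] := goodG; apply.
have G0G : G = set0 -> False.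
  move=> G0e; apply: (maxG G0); last by right.
  rewrite G0e; split=> // G0s; have [[sg _] _] := (fG0, pG0).
  exact: (G0s 0 (subgroup0 sg)).
have [//|[fG pG sG]] := PG.
exists G; split=> // G' fG' pG' GG' x G'x; apply: contrapT => nGx.
apply: (maxG G'); first by split=> [|G'G]; [exact: GG' | apply: nGx; exact: G'G].
by right; split=> // y G0y; apply/GG'/sG.
Qed.

Definition adjoin (A B : zmodType) (G : A * B -> Prop) (x : A) (y : B) :
  A * B -> Prop := fun ab => exists k : int, G (ab.1 - x *~ k, ab.2 - y *~ k).

Lemma adjoin_functional (A B : zmodType) (G : A * B -> Prop) (x : A) (y : B) :
  functional_graph G -> (forall k b, G (x *~ k, b) -> b = y *~ k) ->
  functional_graph (adjoin G x y).
Proof.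
move=> [sgG fG] xy; split.
  split; first by exists 0; rewrite !mulr0z !subr0; exact: subgroup0 sgG.
  move=> [a b] [a' b'] [k /= Gk] [k' /= Gk']; exists (k - k').
  have := subgroupB sgG Gk Gk'; congr G.
  by congr pair; rewrite /= mulrzBr !opprD !opprK addrACA.
move=> b [k /=]; rewrite sub0r => /(subgroupN sgG) Gk.
have /xy : G (x *~ k, - (b - y *~ k)) by rewrite -[x *~ k]opprK.
by rewrite opprB => /eqP; rewrite subr_eq addrC -subr_eq subrr eq_sym => /eqP.
Qed.

Lemma adjoin_sub (A B : zmodType) (G : A * B -> Prop) (x : A) (y : B) ab :
  G ab -> adjoin G x y ab.
Proof. by case: ab => a b Gab; exists 0; rewrite !mulr0z !subr0. Qed.

Lemma adjoin_gen (A B : zmodType) (G : A * B -> Prop) (x : A) (y : B) :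
  is_subgroup G -> adjoin G x y (x, y).
Proof. by move=> sgG; exists 1; rewrite !mulr1z !subrr; exact: subgroup0 sgG. Qed.

(** This is the injectivity of divisible groups: a maximal partial homomorphism not defined at [x]
    could still be extended to [x]. *)
Lemma divisible_extend (E D : zmodType) (G0 : E * D -> Prop) :
  divisible D -> functional_graph G0 ->
  exists f : {additive E -> D}, forall e d, G0 (e, d) -> f e = d.
Proof.
move=> divD fG0.
have [|G [[sgG fG] _ G0G maxG]] := @maximal_graph (fun _ => False) _ _ _ fG0.
  by move=> p a [].
have sgdom := dom_subgroup sgG.
have [x|f fP] := @graph_hom _ _ G sgG fG; last by exists f => e d /G0G/fP.
apply: contrapT => ndom.
suff [y xy] : exists y, forall k b, G (x *~ k, b) -> b = y *~ k.
  apply: ndom; exists y; apply: (maxG (adjoin G x y)).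
  - exact: adjoin_functional.
  - by move=> p a [].
  - exact: adjoin_sub.
  - exact: adjoin_gen.
have [[n [n0 dn]]|non] :=
    pselect (exists n : nat, (0 < n)%N /\ dom G (x *+ n)); last first.
  exists 0 => k b Gk; rewrite mul0rz; apply: fG.
  suff k0 : k = 0 by rewrite k0 mulr0z in Gk.
  apply: contrapT => /eqP k0; apply: non; exists `|k|%N.
  split; first by rewrite absz_gt0.
  have : dom G (x *~ k) by exists b.
  case: (intP k) => [|j|j] //=.
  by move/(subgroupN sgdom); rewrite mulrNz opprK.
have exn : exists n : nat, (0 < n)%N && `[< dom G (x *+ n) >].
  by exists n; rewrite n0; exact/asboolP.
(* Division with remainder shows that the least such [n] divides every [k] with [x *~ k] in the
   domain, so any [y] with [y *+ n = d] is a consistent value at [x]. *)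
case: (ex_minnP exn) => {n n0 dn exn} n /andP[n0 /asboolP[d Gd]] minn.
have [y yd] := divD n d n0; exists y => k b Gk.
have kE := divz_eq k n.
have : exists r : nat, (k %% n)%Z = r.
  have : (0 <= (k %% n)%Z)%R by apply: modz_ge0; rewrite eqz_nat -lt0n.
  by case: (k %% n)%Z => // r _; exists r.
move=> [r rE].
have rn : (r < n)%N by rewrite -ltz_nat -rE; apply: ltz_pmod; rewrite ltz_nat.
have Gn : G ((x *+ n) *~ (k %/ n)%Z, d *~ (k %/ n)%Z).
  by have := subgroupMz sgG (k %/ n)%Z Gd; rewrite pair_mulrz.
have xk : x *~ k = (x *+ n) *~ (k %/ n)%Z + x *+ r.
  by rewrite {1}kE rE mulrzDr mulrC pmulrn -mulrzA.
have r0 : r = 0%N.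
  apply/eqP; rewrite -leqn0 leqNgt; apply/negP => r0.
  have := minn r; rewrite r0 /= => H.
  suff /H : `[< dom G (x *+ r) >] by rewrite leqNgt rn.
  apply/asboolP; exists (b - d *~ (k %/ n)%Z).
  have := subgroupB sgG Gk Gn; congr G; congr pair => /=.
  by rewrite xk addrC addrA addNr add0r.
apply/eqP; rewrite -subr_eq0; apply/eqP/fG.
have := subgroupB sgG Gk Gn; congr G; congr pair => /=.
  by rewrite xk r0 mulr0n addr0 subrr.
by rewrite -yd {2}kE rE r0 addr0 mulrC pmulrn -mulrzA.
Qed.

Definition tower_contra (p : nat) (C : zmodType) : Prop :=
  tower_trivial (fun=> p) C /\ tower_solvable (fun=> p) C.

Lemma subrBB (V : zmodType) (a b c d : V) : (a - b) - (c - d) = (a - c) - (b - d).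
Proof. by rewrite [- (b - d)]opprB opprB [d - c]addrC addrACA [d - b]addrC. Qed.

Lemma bezout_prime (p : nat) (k : int) : prime p -> ~~ (p %| k)%Z ->
  exists u v : int, u * k + v * p = 1.
Proof.
move=> pp pk; have /coprimezP[[u v] /= uv] : coprimez k p.
  by rewrite coprimezE coprime_sym prime_coprime.
by exists u, v.
Qed.

Lemma pure_extend (p : nat) (E C : zmodType) (G0 : E * C -> Prop) :
  prime p -> tower_contra p C -> functional_graph G0 -> pure (eq p) (dom G0) ->
  exists f : {additive E -> C}, forall e c, G0 (e, c) -> f e = c.
Proof.
move=> pp [trivC solvC] fG0 pG0.
have [G [[sgG fG] pG G0G maxG]] := maximal_graph fG0 pG0.
have sgd := dom_subgroup sgG.
(* The sum of the domain and [p E]; maximality will force it to be all of [E]. *)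
pose T x := exists y, dom G (x - y *+ p).
have sgT : is_subgroup T.
  split; first by exists 0; rewrite mul0rn subr0; exact: subgroup0 sgd.
  move=> x x' [y dy] [y' dy']; exists (y - y').
  by rewrite mulrnBl -subrBB; exact: subgroupB.
have Tp x : T (x *+ p) by exists x; rewrite subrr; exact: subgroup0 sgd.
have domT x : dom G x -> T x by exists 0; rewrite mul0rn subr0.
have T1 x k : ~~ (p %| k)%Z -> T (x *~ k) -> T x.
  move=> /(bezout_prime pp)[u [v uv]] Tk; rewrite -[x]mulr1z -uv mulrzDr.
  rewrite (mulrC u) (mulrC v) !mulrzA; apply: (subgroupD sgT).
    exact: subgroupMz.
  by apply: subgroupMz => //; exact: Tp.
have Tall x : T x.
  apply: contrapT => nTx.
  (* Purity strips the factors [p] from [n], and a multiple prime to [p] in the domain would put [x]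
     in [T]. *)
  have nd n : (0 < n)%N -> ~ dom G (x *+ n).
    elim/ltn_ind: n => n IHn n0 dn.
    have [/dvdnP[m mE]|pn] := boolP (p %| n)%N; last first.
      by apply: nTx; apply: (@T1 _ n) => //; exact: domT.
    have m0 : (0 < m)%N by rewrite mE muln_gt0 in n0; case/andP: n0.
    apply: (IHn m) => //; first by rewrite mE ltn_Pmulr // prime_gt1.
    by apply: (pG p) => //; rewrite -mulrnA -mE.
  apply: (nTx); apply: (domT); exists 0; apply: (maxG (adjoin G x 0)).
  - apply: adjoin_functional => // k c Gk; rewrite mul0rz.
    case: (intP k) Gk => [|n|n] Gk; first by apply: fG; rewrite mulr0z in Gk.
      by case: (nd n.+1) => //; exists c.
    case: (nd n.+1) => //; exists (- c); rewrite -[x *+ _]opprK.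
    by apply: (subgroupN sgG Gk).
  (* Purity survives: if [p] does not divide [k], then [x *~ k] in [T] would put [x] in [T];
     otherwise the relation can be divided by [p]. *)
  - move=> _ e <- [c [k /= Gk]].
    have de : dom G (e *+ p - x *~ k) by eexists; exact: Gk.
    have [/dvdzP[m mE]|pk] := boolP (p %| k)%Z; last first.
      case: nTx; apply: (T1 _ _ pk).
      rewrite -[x *~ k](subKr (e *+ p)); apply: (subgroupB sgT) => //.
      exact: domT.
    have [|b Gb] := pG p (e - x *~ m) erefl.
      by rewrite mulrnBl (pmulrn (x *~ m)) -mulrzA -mE.
    by exists b, m; rewrite /= mul0rz subr0.
  - exact: adjoin_sub.
  - exact: adjoin_gen.
(* These are the pairs with an expansion in powers of [p] whose digits lie in [G]. Together with
   [Tall], solvability in [C] makes the relation total; triviality makes it single-valued. *)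
pose G' (ec : E * C) := exists v : nat -> E * C,
  v 0%N = ec /\ forall n, G (v n - v n.+1 *+ p).
have sgG' : is_subgroup G'.
  split.
    exists (fun=> 0); split=> // n; rewrite mul0rn subr0.
    exact: subgroup0 sgG.
  move=> _ _ [v [<- vG]] [w [<- wG]]; exists (fun n => v n - w n); split=> // n.
  by rewrite mulrnBl -subrBB; exact: subgroupB.
have [c [v [v0 vG]]|e|f fP] := @graph_hom _ _ _ sgG'; last first.
- exists f => e c /G0G Gec; apply: fP.
  exists (fun n => if n is 0%N then (e, c) else 0); split=> // -[|n].
    by rewrite mul0rn subr0.
  by rewrite mul0rn subr0; exact: subgroup0 sgG.
- have [s sP] := choice Tall.
  have /choice[g gP] : forall n, exists c, G (iter n s e - iter n.+1 s e *+ p, c).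
    by move=> n; exact: sP.
  have [x xP] := solvC g; exists (x 0%N), (fun n => (iter n s e, x n)); split=> // n.
  have := gP n; congr G; rewrite [RHS]surjective_pairing.
  congr pair; first by rewrite (raddfB fst) (raddfMn fst).
  by rewrite (raddfB snd) (raddfMn snd) /= xP addrK.
(* For a pair over [0], purity keeps all first components in the domain; subtracting their values
   under [G] leaves a homogeneous tower in [C]. *)
have /choice[g gP] n : dom G (v n).1.
  elim: n => [|n IHn]; first by rewrite v0; exact: subgroup0 sgd.
  apply: (pG p) => //.
  have : dom G (v n - v n.+1 *+ p).1.
    by exists (v n - v n.+1 *+ p).2; rewrite -surjective_pairing.
  rewrite (raddfB fst) (raddfMn fst) => /(subgroupB sgd IHn).
  by rewrite /= subKr.
have := trivC (fun n => (v n).2 - g n); rewrite v0 /= => tr.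
have g0 : g 0%N = 0 by apply: fG; have := gP 0%N; rewrite v0.
have : c - g 0%N = 0; last by rewrite g0 subr0.
apply: tr => n; apply/eqP; rewrite -subr_eq0; apply/eqP/fG.
have := subgroupB sgG (vG n) (subgroupB sgG (gP n) (subgroupMn sgG p (gP n.+1))).
congr G; rewrite [LHS]surjective_pairing; congr pair.
  by rewrite !(raddfB fst, raddfMn fst) /= subrr.
by rewrite !(raddfB snd, raddfMn snd) /= mulrnBl subrBB.
Qed.

(** * Unions of chains of cyclic groups *)

(** Sequences modulo eventual equality can receive data defined only from some stage of a chain on,
    such as the coordinate of an element along [g N]. *)
Lemma germs_exist (C : zmodType) :
  exists (V : zmodType) (pi : {additive zprod (fun _ : nat => C) -> V}),
    forall w w', pi w = pi w' <-> exists N, forall n, (N <= n)%N -> w n = w' n.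
Proof.
pose S (w : zprod (fun _ : nat => C)) := exists N, forall n, (N <= n)%N -> w n = 0.
have sgS : is_subgroup S.
  split; first by exists 0%N.
  move=> w w' [N wN] [N' wN']; exists (maxn N N') => n.
  rewrite geq_max => /andP[/wN w0 /wN' w'0].
  by rewrite -[LHS]/(w n - w' n) w0 w'0 subrr.
have [V [pi [_ piP]]] := quotient_exists sgS.
exists V, pi => w w'.
have -> : pi w = pi w' <-> pi (w - w') = 0.
  by rewrite raddfB; split=> [->|/eqP]; rewrite ?subrr // subr_eq0 => /eqP.
rewrite piP; split=> -[N wN]; exists N => n /wN.
  by move/eqP; rewrite -[X in X == _]/(w n - w' n) subr_eq0 => /eqP.
by move=> wE; rewrite -[LHS]/(w n - w' n) wE subrr.
Qed.

(* [F] is the union of the increasing chain of the infinite cyclic subgroups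
   generated by the [g n]. *)
Record telescope (F : zmodType) (g : nat -> F) (m : nat -> nat) : Prop := Telescope {
  telescope_free : forall n z, g n *~ z = 0 -> z = 0;
  telescope_step : forall n, g n = g n.+1 *+ m n;
  telescope_union : forall x, exists n z, x = g n *~ z
}.

Section TelescopeTheory.
Variables (F : zmodType) (g : nat -> F) (m : nat -> nat) (telF : telescope g m).

Lemma telescope_inj n z z' : g n *~ z = g n *~ z' -> z = z'.
Proof.
move=> /eqP; rewrite -subr_eq0 -mulrzBr => /eqP/(telescope_free telF)/eqP.
by rewrite subr_eq0 => /eqP.
Qed.

Lemma telescope_up n N z : (n <= N)%N -> exists z', g n *~ z = g N *~ z'.
Proof.
elim: N => [|N IHN]; first by rewrite leqn0 => /eqP ->; exists z.
rewrite leq_eqVlt => /predU1P[->|/IHN[z' ->]]; first by exists z.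
by exists ((m N)%:Z * z'); rewrite (telescope_step telF) mulrzA -pmulrn.
Qed.

Lemma telescope_hom (C : zmodType) (x : nat -> C) :
  (forall n, x n = x n.+1 *+ m n) ->
  exists f : {additive F -> C}, forall n, f (g n) = x n.
Proof.
move=> xP.
pose G (fc : F * C) := exists n z, fc = (g n, x n) *~ z.
have up n N z : (n <= N)%N -> exists z', (g n, x n) *~ z = (g N, x N) *~ z'.
  elim: N => [|N IHN]; first by rewrite leqn0 => /eqP ->; exists z.
  rewrite leq_eqVlt => /predU1P[->|/IHN[z' ->]]; first by exists z.
  exists ((m N)%:Z * z'); rewrite mulrzA -pmulrn; congr (_ *~ _).
  rewrite xP (telescope_step telF) [RHS]surjective_pairing.
  by rewrite (raddfMn fst) (raddfMn snd).
have sgG : is_subgroup G.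
  split; first by exists 0%N, 0; rewrite mulr0z.
  move=> _ _ [n [z ->]] [n' [z' ->]].
  have [t ->] := up n (maxn n n') z (leq_maxl _ _).
  have [t' ->] := up n' (maxn n n') z' (leq_maxr _ _).
  by exists (maxn n n'), (t - t'); rewrite mulrzBr.
have [||f fP] := graph_hom sgG.
- move=> b [n [z]]; rewrite pair_mulrz => -[/esym/(telescope_free telF) -> ->].
  exact: mulr0z.
- move=> a; have [n [z ->]] := telescope_union telF a.
  by exists (x n *~ z), n, z; rewrite pair_mulrz.
by exists f => n; apply: fP; exists n, 1; rewrite mulr1z.
Qed.

(** Every tensor has the form [tA (g n) a]. If its image vanishes, then at some later stage [N] the
    coefficient of [g n] along [g N] kills [i a], hence [a], hence the tensor. *)
Lemma telescope_flat : flat F.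
Proof.
move=> A B i injI FA FB tA tB [[tAl tAr] uA] [[tBl tBr] uB] h hP.
have tA0 x : tA x 0 = 0 by have := tAl x 0 0; rewrite !subrr.
have tAMz x z a : tA (x *~ z) a = tA x (a *~ z).
  pose ml := GRing.isZmodMorphism.Build _ _ (tA x) (tAl x).
  pose fl : {additive A -> FA} := HB.pack (tA x) ml.
  pose mr := GRing.isZmodMorphism.Build _ _ (tA^~ a) (tAr a).
  pose fr : {additive F -> FA} := HB.pack (tA^~ a) mr.
  by rewrite -[LHS]/(fr _) -[RHS]/(fl _) !raddfMz.
pose S xi := exists n a, xi = tA (g n) a.
have up n N a : (n <= N)%N -> exists a', tA (g n) a = tA (g N) a'.
  move=> /(telescope_up 1)[z]; rewrite mulr1z => ->.
  by exists (a *~ z); rewrite tAMz.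
have sgS : is_subgroup S.
  split; first by exists 0%N, 0; rewrite tA0.
  move=> _ _ [n [a ->]] [n' [a' ->]].
  have [b ->] := up n (maxn n n') a (leq_maxl _ _).
  have [b' ->] := up n' (maxn n n') a' (leq_maxr _ _).
  by exists (maxn n n'), (b - b'); rewrite tAl.
(* The projection to the quotient by [S] and the zero map agree on all pure tensors, so the
   universal property identifies them. *)
have Sall xi : S xi.
  have [Q [pi [_ piP]]] := quotient_exists sgS.
  have [|k [_ kU]] := uA Q (fun _ _ => 0).
    by split=> ? ? ?; rewrite subrr.
  apply/piP; rewrite (kU pi) => [|x a].
    by symmetry; apply: (kU (\0 : {additive FA -> Q})).
  apply/piP; have [n [z ->]] := telescope_union telF x.
  by exists n, (a *~ z); rewrite tAMz.
suff ker xi : h xi = 0 -> xi = 0.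
  move=> x y hxy; apply/eqP; rewrite -subr_eq0; apply/eqP/ker.
  by rewrite raddfB hxy subrr.
have [n [a ->]] := Sall xi; rewrite hP => tB0.
have [V [pi piP]] := germs_exist B.
(* The coordinate of [x] along [g N]; the default [0] serves only the finitely many stages before
   [x] appears in the chain. *)
have /choice[coef coefP] : forall xN : F * nat, exists z,
    forall t, xN.1 = g xN.2 *~ t -> z = t.
  move=> [x N] /=; have [[z zE]|nz] := pselect (exists z, x = g N *~ z).
    by exists z => t; rewrite zE => /telescope_inj.
  by exists 0 => t xt; case: nz; exists t.
pose w x b : zprod (fun _ : nat => B) := fun N => b *~ coef (x, N).
have [|k [kE _]] := uB V (fun x b => pi (w x b)).
  split=> [x b b'|b x x']; rewrite -raddfB.
    congr (pi _); apply: functional_extensionality_dep => N; exact: mulrzBl.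
  apply/piP.
  have [n1 [z1 ->]] := telescope_union telF x.
  have [n2 [z2 ->]] := telescope_union telF x'.
  exists (maxn n1 n2) => N; rewrite geq_max => /andP[n1N n2N].
  have [y1 e1] := telescope_up z1 n1N; have [y2 e2] := telescope_up z2 n2N.
  rewrite -[RHS]/(w _ _ _ - w _ _ _) /w.
  rewrite (coefP (_ - _, N) (y1 - y2)) /=; last by rewrite e1 e2 mulrzBr.
  by rewrite (coefP (_, N) y1 e1) (coefP (_, N) y2 e2) mulrzBr.
have : pi (w (g n) (i a)) = pi 0 by rewrite -kE tB0 !raddf0.
move=> /piP[N wN].
have nN : (n <= maxn n N)%N by rewrite leq_maxl.
have [z] := telescope_up 1 nN; rewrite mulr1z => gz.
have := wN (maxn n N) (leq_maxr _ _); rewrite /w (coefP (_, _) z gz) -raddfMz.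
rewrite -[RHS]/(0 : B) -[RHS](raddf0 i) => /injI az.
by rewrite gz tAMz az tA0.
Qed.

(** An extension of [F] by [C] is built with lifts [e n] of [g n] satisfying
    [e n = a n + m n e (n+1)]; a retraction onto [C] sends these lifts to a solution. *)
Lemma telescope_solvable (C : zmodType) : Ext1_eq0 F C -> tower_solvable m C.
Proof.
move=> extF a.
have [V [pi piP]] := germs_exist C.
(* [sd k n] is the expansion of the unknown [x n] cut off after [k] terms. As a germ in the bound
   [N], it replaces an infinite sum that need not make sense in [C]. *)
pose sd := fix sd (k n : nat) {struct k} : C :=
  if k is k'.+1 then a n + sd k' n.+1 *+ m n else 0.
pose W c n z : zprod (fun _ : nat => C) := fun N => c + sd (N - n)%N n *~ z.
pose S (xw : F * V) := exists n z c, xw = (g n *~ z, pi (W c n z)).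
have up n N z c : (n <= N)%N -> exists z' c',
    (g n *~ z, pi (W c n z)) = (g N *~ z', pi (W c' N z')).
  elim: N => [|N IHN]; first by rewrite leqn0 => /eqP ->; exists z, c.
  rewrite leq_eqVlt => /predU1P[->|/IHN[z' [c' ->]]]; first by exists z, c.
  exists ((m N)%:Z * z'), (c' + a N *~ z'); congr pair.
    by rewrite (telescope_step telF) mulrzA -pmulrn.
  apply/piP; exists N.+1 => k Nk; rewrite /W -(subnSK Nk) /= mulrzDl addrA.
  by rewrite mulrzA -pmulrn.
have WB c c' n z z' : W c n z - W c' n z' = W (c - c') n (z - z').
  apply: functional_extensionality_dep => N.
  rewrite -[LHS]/(W c n z N - W c' n z' N) /W.
  by rewrite mulrzBr opprD addrACA.
have sgS : is_subgroup S.
  split; first exists 0%N, 0, 0.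
    rewrite mulr0z; congr pair; rewrite -(raddf0 pi); congr (pi _).
    by apply: functional_extensionality_dep => N; rewrite /W mulr0z addr0.
  move=> _ _ [n [z [c ->]]] [n' [z' [c' ->]]].
  have [t [d ->]] := up n (maxn n n') z c (leq_maxl _ _).
  have [t' [d' ->]] := up n' (maxn n n') z' c' (leq_maxr _ _).
  exists (maxn n n'), (t - t'), (d - d'); rewrite -WB (raddfB pi) mulrzBr.
  by congr pair.
have [U [u [uI uS]]] := subgroup_exists sgS.
have lift n z c : exists y, u y = (g n *~ z, pi (W c n z)).
  by apply/uS; exists n, z, c.
pose G (cy : C * U) := u cy.2 = (0, pi (W cy.1 0%N 0)).
have sgG : is_subgroup G.
  split.
    rewrite /G raddf0 /=; congr pair; rewrite -(raddf0 pi); congr (pi _).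
    by apply: functional_extensionality_dep => N; rewrite /W mulr0z addr0.
  move=> [c y] [c' y']; rewrite /G /= raddfB => -> ->.
  have -> : W (c - c') 0%N 0 = W c 0%N 0 - W c' 0%N 0 by rewrite WB subr0.
  by rewrite (raddfB pi); congr pair; rewrite subr0.
have [||j jP'] := graph_hom sgG.
- move=> y; rewrite /G /= => uy; apply: uI; rewrite uy raddf0; congr pair.
  rewrite -(raddf0 pi); congr (pi _).
  by apply: functional_extensionality_dep => N; rewrite /W mulr0z addr0.
- by move=> c; have [y] := lift 0%N 0 c; rewrite mulr0z; exists y.
have jP c : u (j c) = (0, pi (W c 0%N 0)).
  have [y uy] := lift 0%N 0 c; rewrite mulr0z in uy.
  by rewrite (jP' c y).
have jI : injective j.
  move=> c c' jcc; have := jP c; rewrite jcc jP => -[/piP[N wN]].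
  by have := wN N (leqnn N); rewrite /W !mulr0z !addr0.
pose q : {additive U -> F} := fst \o u.
have qS x : exists e, q e = x.
  have [n [z ->]] := telescope_union telF x; have [y uy] := lift n z 0.
  by exists y; rewrite /q /= uy.
have qE e : q e = 0 <-> exists c, j c = e.
  split=> [|[c <-]]; last by rewrite /q /= jP.
  have [n [z [c uE]]] : S (u e) by apply/uS; exists e.
  rewrite /q /= uE => /(telescope_free telF) z0; exists c; apply: uI.
  rewrite jP uE z0 mulr0z; congr pair.
have [r rP] := split_retract (extF (Extension jI qS qE)).
have /choice[e eP] n := lift n 1 0.
exists (fun n => r (e n)) => n.
suff eE : e n = j (a n) + e n.+1 *+ m n.
  by rewrite {1}eE raddfD raddfMn (rP (a n)).
apply: uI; rewrite raddfD raddfMn !eP jP.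
rewrite [RHS]surjective_pairing !(raddfD fst, raddfD snd, raddfMn fst, raddfMn snd) /=.
congr pair; first by rewrite add0r !mulr1z (telescope_step telF).
(* Beyond stage [n] the cut-off sum starting at [n] is nonempty, so its first term [a n] can be
   split off. *)
rewrite -raddfMn -raddfD; apply/piP; exists n.+1 => N nN.
rewrite -[RHS]/(W _ _ _ N + (W _ _ _ *+ _) N).
have -> k (v : zprod (fun _ : nat => C)) : (v *+ k) N = v N *+ k.
  by elim: k => // k IHk; rewrite !mulrS -IHk.
by rewrite /W -(subnSK nN) /= !mulr1z mulr0z addr0 !add0r.
Qed.

End TelescopeTheory.

Lemma rat_telescope :
  telescope (fun n => (n`!)%:R^-1 : rat) (fun n => n.+1).
Proof.
have fact0 n : (n`!)%:R != 0 :> rat by rewrite pnatr_eq0 -lt0n fact_gt0.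
split=> [n z /eqP|n|x] /=.
- by rewrite mulrz_eq0 (negPf (invr_neq0 (fact0 n))) orbF => /eqP.
- by rewrite factS natrM invfM -[RHS]mulr_natl mulrA divff ?mul1r // pnatr_eq0.
- have [d dE] : exists d : nat, denq x = d.
    by have := denq_gt0 x; case: (denq x) => // d _; exists d.
  have d0 : (0 < d)%N by have := denq_gt0 x; rewrite dE ltz_nat.
  (* The denominator divides its own factorial, so [x] lies in the cyclic group of stage [d]. *)
  have /dvdnP[k kE] : (d %| d`!)%N by rewrite dvdn_fact // d0 leqnn.
  exists d, (numq x * k); rewrite -[LHS]divq_num_den dE -[RHS]mulrzl kE natrM.
  have d0' : d%:R != 0 :> rat by rewrite pnatr_eq0 -lt0n.
  have k0 : k%:R != 0 :> rat.
    by have := fact0 d; rewrite kE natrM mulf_eq0 => /norP[].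
  by rewrite rmorphM /= -!pmulrn invfM mulrA mulfK.
Qed.

Lemma Zinv_gen (p : primes_type) (n : nat) :
  ((val p)%:R ^+ n)^-1 \in Zinv_pred p.
Proof. by apply/asboolP; exists 1, n; rewrite mul1r. Qed.

Definition Zinv_invp (p : primes_type) (n : nat) : Zinv p :=
  exist (fun x => x \in Zinv_pred p) _ (Zinv_gen p n).

Lemma Zinv_telescope (p : primes_type) :
  telescope (Zinv_invp p) (fun=> val p).
Proof.
have p0 : (val p)%:R != 0 :> rat.
  by rewrite pnatr_eq0 -lt0n; apply/prime_gt0/(valP p).
split=> [n z /(congr1 val) /eqP|n|[x xp]].
- rewrite raddfMz raddf0 /= mulrz_eq0 (negPf (invr_neq0 (expf_neq0 n p0))) orbF.
  by move/eqP.
- apply: val_inj; rewrite raddfMn /= exprS invfM -[RHS]mulr_natl mulrA divff //.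
  by rewrite mul1r.
- have /asboolP[a [n xE]] := xp; exists n, a; apply: val_inj.
  by rewrite raddfMz /= xE -[RHS]mulrzl.
Qed.

(** * Torsion-freeness and extension of homomorphisms *)

Lemma flat_torsion_free (F : zmodType) (n : nat) (x : F) :
  flat F -> (0 < n)%N -> x *+ n = 0 -> x = 0.
Proof.
move=> flatF n0 xn.
(* [F] is itself a tensor product of [F] with the integers, and there multiplication by [n] on the
   integers induces multiplication by [n] on [F]. *)
have tensF : is_tensor (fun (x : F) (a : int) => x *~ a).
  split; first by split=> [y a b|a y z]; rewrite (mulrzBr, mulrzBl).
  move=> V g [gl gr].
  pose hM := GRing.isZmodMorphism.Build _ _ (g^~ 1) (gr 1).
  pose h : {additive F -> V} := HB.pack (g^~ 1) hM.
  exists h; split=> [y a|h' h'P y]; last by rewrite -[y]mulr1z h'P.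
  pose kM := GRing.isZmodMorphism.Build _ _ (g y) (gl y).
  pose k : {additive int -> V} := HB.pack (g y) kM.
  by rewrite raddfMz -[LHS]/(k 1 *~ a) -raddfMz -[RHS]/(k a) intz.
pose mulB (V : zmodType) : zmod_morphism (fun y : V => y *+ n) :=
  fun y z => mulrnBl n y z.
pose i : {additive int -> int} := HB.pack (fun a : int => a *+ n)
  (GRing.isZmodMorphism.Build _ _ _ (mulB int)).
pose h : {additive F -> F} := HB.pack (fun y : F => y *+ n)
  (GRing.isZmodMorphism.Build _ _ _ (mulB F)).
have iI : injective i.
  move=> a b /= /eqP; rewrite -subr_eq0 -mulrnBl mulrn_eq0 eqn0Ngt n0.
  by rewrite subr_eq0 => /eqP.
have hI : injective h.
  apply: (flatF _ _ i iI _ _ _ _ tensF tensF) => y a.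
  by rewrite /= (raddfMn ( *~%R y)).
by apply: hI; rewrite raddf0.
Qed.

Lemma extend_graph (A B E : zmodType) (j : {additive A -> E})
    (f : {additive A -> B}) : injective j ->
  functional_graph (fun eb : E * B => exists a, eb = (j a, f a)).
Proof.
move=> jI; split.
  split; first by exists 0; rewrite !raddf0.
  by move=> _ _ [a ->] [a' ->]; exists (a - a'); rewrite !raddfB.
move=> b [a [/esym ja0 ->]].
by have -> : a = 0; [apply: jI; rewrite ja0 raddf0 | rewrite raddf0].
Qed.

Lemma contra_extension_hom (p : nat) (F C B : zmodType) (E : extension F C)
    (f : {additive C -> B}) :
  prime p -> tower_contra p B -> (forall x : F, x *+ p = 0 -> x = 0) ->
  exists g : {additive ext_mid E -> B}, forall c, g (ext_inj E c) = f c.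
Proof.
move=> pp cB pF.
have fG := extend_graph f (@ext_injP _ _ E).
have [|g gP] := pure_extend pp cB fG.
  (* The image of [C] is [p]-pure because the cokernel [F] has no [p]-torsion. *)
  move=> _ e <- [b [c [ce _]]].
  have [|c' c'E] := (ext_exactP e).1; last by exists (f c'), c'; rewrite c'E.
  by apply: pF; rewrite -raddfMn ce; apply/ext_exactP; exists c.
by exists g => c; apply: gP; exists c.
Qed.

Lemma divisible_extension_hom (F C D : zmodType) (E : extension F C)
    (f : {additive C -> D}) : divisible D ->
  exists g : {additive ext_mid E -> D}, forall c, g (ext_inj E c) = f c.
Proof.
move=> divD.
have [g gP] := divisible_extend divD (extend_graph f (@ext_injP _ _ E)).
by exists g => c; apply: gP; exists c.
Qed.

(** Homogeneous towers are the values of homomorphisms from Z[1/p] on its generators. Since Z[1/p]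
    has no [p]-torsion, the identity of [C] extends over any extension by it, which gives a
    retraction. *)
Lemma contramoduleP (p : primes_type) (C : zmodType) :
  contramodule p C <-> tower_contra (val p) C.
Proof.
have telp := Zinv_telescope p; have pp : prime (val p) := valP p.
split=> [[homC extC]|[trivC solvC]].
  split; last exact: (telescope_solvable telp extC).
  move=> x xP; have [f fP] := telescope_hom telp xP.
  by rewrite -fP homC.
split=> [f a|E].
  have [n [z aE]] := telescope_union telp a.
  have := trivC (fun k => f (Zinv_invp p (n + k))).
  rewrite addn0 aE raddfMz => ->; first exact: mul0rz.
  by move=> k; rewrite -raddfMn addnS -(telescope_step telp).
have [|r rP] := @contra_extension_hom _ _ _ _ E idfun pp (conj trivC solvC).
  move=> x; have [n [z ->]] := telescope_union telp x.
  rewrite pmulrn -mulrzA => /(telescope_free telp)/eqP.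
  by rewrite mulf_eq0 => /predU1P[->|]; rewrite ?mulr0z // eqz_nat eqn0Ngt prime_gt0.
exact: retract_split rP.
Qed.

(** * The decomposition *)

Lemma prime_mul_ind (P : nat -> Prop) : P 1%N ->
  (forall q n, prime q -> P n -> P (q * n)%N) -> forall n, (0 < n)%N -> P n.
Proof.
move=> P1 PM; elim/ltn_ind => n IHn n0.
have [->//|n1] := eqVneq n 1%N.
have n2 : (1 < n)%N by rewrite ltn_neqAle eq_sym n1.
rewrite -(divnK (pdiv_dvd n)) mulnC; apply: PM; first exact: pdiv_prime.
apply: IHn; first by rewrite ltn_Pdiv // prime_gt1 // pdiv_prime.
by rewrite divn_gt0 ?pdiv_gt0 // dvdn_leq // pdiv_dvd.
Qed.

Lemma contra_prime_divisible (p q : nat) (C : zmodType) :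
  prime p -> prime q -> p != q -> tower_contra p C ->
  (forall y : C, y *+ q = 0 -> y = 0) /\ (forall c : C, exists y, y *+ q = c).
Proof.
move=> pp pq npq [trivC solvC].
have [|u [v uv]] := @bezout_prime p q%:Z pp.
  by rewrite -[(_ %| _)%Z]/(p %| q)%N dvdn_prime2.
have decomp (y : C) : y = y *+ q *~ u + y *~ v *+ p.
  by rewrite -{1}[y]mulr1z -uv mulrzDr (mulrC u) mulrzA -pmulrn mulrzA -pmulrn.
split=> [y yq|c].
  (* Here [y = p v y], so the multiples of [y] by powers of [v] form a homogeneous tower. *)
  have := trivC (fun k => y *~ (v ^+ k)); rewrite expr0 mulr1z; apply=> k.
  rewrite {1}[y]decomp yq mul0rz add0r exprS !pmulrn -!mulrzA; congr (_ *~ _).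
  by ring.
(* The solution is 1 / q = u / (1 - v p) = sum_k u v^k p^k. *)
have [x xP] := solvC (fun k => c *~ (v ^+ k)).
(* The sequences [x k.+1] and [x k *~ v] solve the same system, so uniqueness applies. *)
have xS : x 1%N = x 0%N *~ v.
  apply/eqP; rewrite -subr_eq0; apply/eqP.
  apply: (trivC (fun k => x k.+1 - x k *~ v)) => k.
  by rewrite mulrnBl {1}(xP k.+1) {1}(xP k) mulrzDl exprSr mulrzA
    opprD addrACA subrr add0r; congr (_ - _); rewrite !pmulrn -!mulrzA mulrC.
exists (x 0%N *~ u).
have := xP 0%N; rewrite expr0 mulr1z xS => x0.
have := decomp (x 0%N); rewrite {1}x0 => /addIr ->.
by rewrite !pmulrn -!mulrzA mulrC.
Qed.

(** Steps are taken in blocks of [p]: a product of [p] consecutive multipliers is divisible by [p],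
    and absorbing the remaining cofactors into [t] leaves a tower for [p]. *)
Lemma trivial_tower_factorial (p : nat) (C : zmodType) :
  (0 < p)%N -> tower_trivial (fun=> p) C -> tower_trivial (fun n => n.+1) C.
Proof.
move=> p0 trivC z zP.
have up n j : z n = z (n + j)%N *+ ((n + j) ^_ j).
  elim: j => [|j IHj]; first by rewrite addn0 ffactn0.
  by rewrite IHj addnS ffactSS zP mulrnA.
have ffE k : ((k * p + p) ^_ p = 'C(k * p + p, p) * (p.-1)`! * p)%N.
  rewrite -bin_ffact -mulnA; congr (_ * _)%N.
  by case: (p) p0 => // p' _; rewrite mulnC factS.
pose t := fix t (k : nat) : nat :=
  if k is k'.+1 then (t k' * ('C(k' * p + p, p) * (p.-1)`!))%N else 1%N.
have := trivC (fun k => z (k * p)%N *+ t k); rewrite mul0n mulr1n; apply=> k.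
rewrite (up (k * p)%N p) ffE mulSn [(p + _)%N]addnC -!mulrnA /=.
by congr (_ *+ _); rewrite [LHS]mulnC !mulnA.
Qed.

(** These elements form the largest [p]-divisible subgroup. A coherent sequence of roots is
    demanded, which is stronger than divisibility by each power of [p]. *)
Definition pdiv_part (p : nat) (C : zmodType) (c : C) : Prop :=
  exists x : nat -> C, x 0%N = c /\ forall n, x n = x n.+1 *+ p.

Lemma pdiv_part_subgroup (p : nat) (C : zmodType) : is_subgroup (@pdiv_part p C).
Proof.
split; first by exists (fun=> 0); split=> // n; rewrite mul0rn.
move=> _ _ [x [<- xP]] [y [<- yP]]; exists (fun n => x n - y n); split=> // n.
by rewrite mulrnBl -xP -yP.
Qed.

Lemma pdiv_part_hom (p : nat) (A B : zmodType) (f : {additive A -> B}) a :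
  pdiv_part p a -> pdiv_part p (f a).
Proof.
by move=> [x [<- xP]]; exists (f \o x); split=> // n; rewrite /= -raddfMn -xP.
Qed.

Lemma pdiv_part_trivial (p : nat) (C : zmodType) (c : C) :
  tower_trivial (fun=> p) C -> pdiv_part p c -> c = 0.
Proof. by move=> trivC [x [<- xP]]; exact: trivC. Qed.

Lemma pdiv_partS (p : nat) (C : zmodType) (S : C -> Prop) (c : C) :
  (forall a, S a -> exists b, S b /\ a = b *+ p) -> S c -> pdiv_part p c.
Proof.
move=> Sp Sc.
have /choice[s sP] : forall a, exists b, S a -> S b /\ a = b *+ p.
  move=> a; have [/Sp[b bP]|nSa] := pselect (S a); first by exists b.
  by exists 0.
have Sn n : S (iter n s c) by elim: n => // n /sP[].
by exists (fun n => iter n s c); split=> // n; have [] := sP _ (Sn n).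
Qed.

Lemma pdiv_partE (p : nat) (C : zmodType) (c : C) :
  pdiv_part p c -> exists b, pdiv_part p b /\ c = b *+ p.
Proof.
move=> [x [<- xP]]; exists (x 1%N); split; last exact: xP.
by exists (fun n => x n.+1); split=> // n; exact: xP.
Qed.

Lemma contra_quotient (p : nat) (C : zmodType) : tower_solvable (fun=> p) C ->
  exists (Q : zmodType) (pi : {additive C -> Q}),
    [/\ forall y, exists x, pi x = y, forall x, pi x = 0 <-> pdiv_part p x &
        tower_contra p Q].
Proof.
move=> solvC.
have [Q [pi [piS piP]]] := quotient_exists (pdiv_part_subgroup p C).
exists Q, pi; split=> //; have [sec secP] := choice piS.
split=> [x xP|a]; last first.
  have [y yP] := solvC (sec \o a); exists (pi \o y) => n /=.
  by rewrite yP raddfD raddfMn /= secP.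
rewrite -(secP (x 0%N)); apply/piP.
(* The lifted tower has errors [d n] in the [p]-divisible part. Corrections [z n] are found there
   successively by dividing by [p], starting from [0] so that the initial term is kept. *)
pose d n := sec (x n) - sec (x n.+1) *+ p.
have dD n : pdiv_part p (d n).
  by apply/piP; rewrite /d raddfB raddfMn !secP -xP subrr.
have /choice[s sP] : forall nc : nat * C, exists c', pdiv_part p nc.2 ->
    pdiv_part p c' /\ nc.2 - d nc.1 = c' *+ p.
  move=> [n c]; have [cD|] := pselect (pdiv_part p c); last by exists 0.
  by have [b] := pdiv_partE (subgroupB (pdiv_part_subgroup p C) cD (dD n)); exists b.
pose z := fix z (n : nat) : C := if n is n'.+1 then s (n', z n') else 0.
have zD n : pdiv_part p (z n).
  elim: n => [|n /(sP (n, _))[]] //; exact: subgroup0 (pdiv_part_subgroup p C).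
exists (fun n => sec (x n) - z n); rewrite subr0; split=> // n.
have [_ /= zS] := sP (n, z n) (zD n).
by rewrite mulrnBl -zS /d opprB addrA subrKC.
Qed.

Lemma decomposition_exists (C : zmodType) :
  tower_solvable (fun n => n.+1) C ->
  (forall p : primes_type, tower_solvable (fun=> val p) C) ->
  exists (D : zmodType) (Cp : primes_type -> zmodType),
    cotorsion_decomposition C D Cp.
Proof.
move=> solvQ solvP.
have /choice[Qpi QpiP] : forall p : primes_type,
    exists Qpi : {Q : zmodType & {additive C -> Q}},
    [/\ forall y, exists x, projT2 Qpi x = y,
        forall x, projT2 Qpi x = 0 <-> pdiv_part (val p) x &
        tower_contra (val p) (projT1 Qpi)].
  by move=> p; have [Q [pi piP]] := contra_quotient (solvP p); exists (existT _ Q pi).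
pose Q p := projT1 (Qpi p).
pose pi p : {additive C -> Q p} := projT2 (Qpi p).
have piS p y : exists x, pi p x = y by have [] := QpiP p.
have piE p x : pi p x = 0 <-> pdiv_part (val p) x by have [] := QpiP p.
have Qcontra p : tower_contra (val p) (Q p) by have [] := QpiP p.
have Qdiv p q : prime q -> val p <> q ->
    (forall y : Q p, y *+ q = 0 -> y = 0) /\ forall c : Q p, exists y, y *+ q = c.
  by move=> pq /eqP npq; apply: contra_prime_divisible (Qcontra p); rewrite ?(valP p).
pose Pi0 c : zprod Q := fun p => pi p c.
have Pi0B : zmod_morphism Pi0.
  by move=> x y; apply: functional_extensionality_dep => p; rewrite /Pi0 raddfB.
have [Pi PiE] : exists Pi : {additive C -> zprod Q}, forall c p, Pi c p = pi p c.
  pose Pi : {additive C -> zprod Q} :=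
    HB.pack Pi0 (GRing.isZmodMorphism.Build _ _ Pi0 Pi0B).
  by exists Pi.
have mulnE k (y : zprod Q) p : (y *+ k) p = y p *+ k.
  by elim: k => // k IHk; rewrite !mulrS -IHk.
(* One prime factor [q] is treated at a time: [a] matches the coordinate at [q], and the error in
   every other coordinate is divisible by [q]. *)
have PiP n : (0 < n)%N -> forall y : zprod Q, exists a y', y = Pi a + y' *+ n.
  move: n; apply: prime_mul_ind => [y|q n pq IHn y].
    by exists 0, y; rewrite raddf0 add0r.
  pose q' : primes_type := exist _ q pq.
  have [a aE] := piS q' (y q').
  have /dep_choice[z zE] : forall p, exists z : Q p, y p - pi p a = z *+ q.
    move=> p; have [pE|npq] := pselect (p = q').
      by exists 0; rewrite pE aE subrr mul0rn.
    have [|_ /(_ (y p - pi p a))[z <-]] := Qdiv p q pq; last by exists z.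
    by move=> pE; apply: npq; apply: val_inj.
  have [b [y' yE]] := IHn z.
  exists (a + b *+ q), y'; apply: functional_extensionality_dep => p.
  have /= zp := congr1 (fun w : zprod Q => w p) yE.
  rewrite -[RHS]/(Pi (a + b *+ q) p + (y' *+ (q * n)) p) mulnE PiE.
  rewrite -[LHS](subrK (pi p a)) zE zp -[X in X *+ q]/(Pi b p + (y' *+ n) p) mulnE PiE.
  by rewrite raddfD raddfMn mulrnDl -mulrnA mulnC addrC addrA.
have PiS y : exists x, Pi x = y.
  (* Iteration gives [w n = Pi (a n) + (n+1) w (n+1)] with [w 0 = y]. If [x] solves the system of
     the [a n] in [C], the differences [w n - Pi (x n)] form a homogeneous tower, so the initial one
     vanishes. *)
  have /choice[st stP] : forall ny : nat * zprod Q, exists ay : C * zprod Q,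
      ny.2 = Pi ay.1 + ay.2 *+ ny.1.+1.
    by move=> [n w]; have [a [w' wE]] := PiP n.+1 isT w; exists (a, w').
  pose w := fix w (n : nat) : zprod Q :=
    if n is n'.+1 then (st (n', w n')).2 else y.
  have [x xP] := solvQ (fun n => (st (n, w n)).1).
  exists (x 0%N); apply/eqP; rewrite eq_sym -subr_eq0; apply/eqP.
  apply: functional_extensionality_dep => p; have [trivQ _] := Qcontra p.
  apply: (trivial_tower_factorial (prime_gt0 (valP p)) trivQ
            (x := fun n => (w n - Pi (x n)) p)) => n.
  have /= wE := stP (n, w n).
  rewrite -mulnE; congr (_ p); rewrite mulrnBl {1}wE.
  by rewrite (xP n) raddfD raddfMn opprD addrACA subrr add0r.
pose S (c : C) := forall p : primes_type, pdiv_part (val p) c.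
have sgS : is_subgroup S.
  split=> [p|x y Sx Sy p]; first exact: (subgroup0 (pdiv_part_subgroup _ _)).
  by exact: (subgroupB (pdiv_part_subgroup _ _) (Sx p) (Sy p)).
have [D [i [iI iS]]] := subgroup_exists sgS.
have divD : divisible D.
  move=> n x n0; move: n n0 x; apply: prime_mul_ind => [x|q n pq IHn x].
    by exists x.
  pose q' : primes_type := exist _ q pq.
  have Sx : S (i x) by apply/iS; exists x.
  have [c [cq cE]] := pdiv_partE (Sx q').
  (* The root stays in the kernel: at [q] it was chosen inside the divisible part, and for the other
     primes [Q p] has no [q]-torsion. *)
  have Sc : S c.
    move=> p; have [->//|npq] := pselect (p = q').
    have [|tf _] := Qdiv p q pq; first by move=> pE; apply: npq; apply: val_inj.
    by apply/piE/tf; rewrite -raddfMn -[X in c *+ X]/(val q') -cE; apply/piE.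
  have [d dE] := (iS c).1 Sc; have [y yE] := IHn d.
  exists y; apply: iI; rewrite mulnC mulrnA yE raddfMn dE.
  by rewrite cE.
have exact_i e : Pi e = 0 <-> exists d, i d = e.
  rewrite -iS; split=> [Pe p|Se]; first by apply/piE; rewrite -PiE Pe.
  by apply: functional_extensionality_dep => p; rewrite PiE; apply/piE.
have [r rP] := divisible_extension_hom (Extension iI PiS exact_i) idfun divD.
have [phi [phiB _ _]] := retract_split rP.
exists D, Q; split=> // [p|]; first exact/contramoduleP.
by exists phi.
Qed.

(** The elements with zero [p]-coordinate form a [p]-divisible subgroup, while [Cp p] contains no
    nonzero infinite tower of roots; thus [pdiv_part] recovers both kinds of summands from [C]. *)
Lemma decomposition_invariants (C D : zmodType) (Cp : primes_type -> zmodType) :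
  cotorsion_decomposition C D Cp ->
  (forall p, exists f : {additive C -> Cp p},
     (forall y, exists x, f x = y) /\ forall x, f x = 0 <-> pdiv_part (val p) x) /\
  exists i : {additive D -> C}, injective i /\
    forall c, (exists d, i d = c) <-> forall p : primes_type, pdiv_part (val p) c.
Proof.
move=> [divD contraC isoC].
have Ccontra p : tower_contra (val p) (Cp p) by exact/contramoduleP.
have [f [g [fK gK]]] := zmod_isoP isoC.
have mulnE k (y : zprod Cp) p : (y *+ k) p = y p *+ k.
  by elim: k => // k IHk; rewrite !mulrS -IHk.
have prjB p : zmod_morphism (fun y : zprod Cp => y p) by [].
pose prj p : {additive zprod Cp -> Cp p} :=
  HB.pack (fun y : zprod Cp => y p) (GRing.isZmodMorphism.Build _ _ _ (prjB p)).
have in1B : zmod_morphism (fun d : D => (d, 0 : zprod Cp)).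
  by move=> d d'; congr pair; rewrite subr0.
pose in1 : {additive D -> (D * zprod Cp)%type} :=
  HB.pack (fun d : D => (d, 0 : zprod Cp)) (GRing.isZmodMorphism.Build _ _ _ in1B).
pose h p : {additive C -> Cp p} := prj p \o (snd \o f).
have hE p x : h p x = 0 <-> pdiv_part (val p) x.
  split=> [hx|/(pdiv_part_hom (h p))]; last exact: pdiv_part_trivial (Ccontra p).1.
  rewrite -[x]fK; apply: (pdiv_part_hom g).
  apply: (@pdiv_partS _ _ (fun y : D * zprod Cp => y.2 p = 0)) => // -[d y] /= yp0.
  have [d' d'E] := divD (val p) d (prime_gt0 (valP p)).
  have /dep_choice[z zE] : forall q, exists z : Cp q,
      y q = z *+ val p /\ (q = p -> z = 0).
    move=> q; have [qp|nqp] := pselect (q = p).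
      by exists 0; rewrite mul0rn qp.
    have [|_ /(_ (y q))[z zE]] :=
      contra_prime_divisible (valP q) (valP p) _ (Ccontra q); last by exists z.
    by apply/eqP => qp; apply: nqp; apply: val_inj.
  exists (d', z); split; first exact: (zE p).2.
  rewrite [RHS]surjective_pairing (raddfMn fst) (raddfMn snd) /= d'E.
  by congr pair; apply: functional_extensionality_dep => q; rewrite mulnE (zE q).1.
split=> [p|].
  exists (h p); split=> // y; have [z zE] : exists z : zprod Cp, z p = y.
    (* The element with coordinate [y] at [p] and zero elsewhere; [y] is transported along the
       equality of indices. *)
    have /dep_choice[z zE] : forall q, exists z : Cp q,
        forall e : p = q, z = ecast q (Cp q) e y.
      move=> q; have [e|ne] := pselect (p = q); last by exists 0.
      by subst q; exists y => e; rewrite (Prop_irrelevance e erefl).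
    by exists z; rewrite (zE p erefl).
  by exists (g (0, z)); rewrite /h /= gK.
exists (g \o in1); split=> [d d' /= /(can_inj gK)[]//|c].
split=> [[d <-] p|cP]; first by apply/hE; rewrite /h /= gK.
exists (f c).1; rewrite /= -[RHS]fK; congr (g _); rewrite [RHS]surjective_pairing.
by congr pair; apply: functional_extensionality_dep => p; symmetry; apply/hE.
Qed.

(** Each coordinate of the isomorphism extends to the middle group: the divisible one by
    injectivity, the others because flat groups are torsion-free. Together they give a retraction
    onto [C]. *)
Lemma decomposition_cotorsion (C D : zmodType) (Cp : primes_type -> zmodType) :
  cotorsion_decomposition C D Cp -> cotorsion C.
Proof.
move=> [divD contraC isoC] F flatF E.
have [f [g [fK gK]]] := zmod_isoP isoC.
have [d dE] := divisible_extension_hom E (fst \o f) divD.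
have prjB p : zmod_morphism (fun c => (f c).2 p) by move=> x y; rewrite raddfB.
pose prj p : {additive C -> Cp p} :=
  HB.pack (fun c => (f c).2 p) (GRing.isZmodMorphism.Build _ _ _ (prjB p)).
have /dep_choice[k kE] : forall p, exists k : {additive ext_mid E -> Cp p},
    forall c, k (ext_inj E c) = prj p c.
  move=> p; apply: (contra_extension_hom _ _ (valP p)); first exact/contramoduleP.
  by move=> x; apply: flat_torsion_free => //; exact: prime_gt0 (valP p).
pose r0 e : (D * zprod Cp)%type := (d e, fun p => k p e).
have r0B : zmod_morphism r0.
  move=> x y; congr pair; first exact: raddfB.
  by apply: functional_extensionality_dep => p; exact: raddfB.
pose r : {additive ext_mid E -> (D * zprod Cp)%type} :=
  HB.pack r0 (GRing.isZmodMorphism.Build _ _ _ r0B).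
apply: (@retract_split _ _ _ (g \o r)) => c.
rewrite /= -[RHS]fK; congr (g _); rewrite [RHS]surjective_pairing /r0 dE.
by congr pair; apply: functional_extensionality_dep => p; rewrite kE.
Qed.

Theorem corollary12p10 (C : zmodType) :
  (cotorsion C <->
     exists (D : zmodType) (Cp : primes_type -> zmodType),
       cotorsion_decomposition C D Cp) /\
  (forall (D D' : zmodType) (Cp Cp' : primes_type -> zmodType),
     cotorsion_decomposition C D Cp -> cotorsion_decomposition C D' Cp' ->
     zmod_iso D D' /\ forall p : primes_type, zmod_iso (Cp p) (Cp' p)).
Proof.
split.
  split=> [cotC|[D [Cp]]]; last exact: decomposition_cotorsion.
  apply: decomposition_exists => [|p].
    exact: (telescope_solvable rat_telescope (cotC _ (telescope_flat rat_telescope))).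
  have telp := Zinv_telescope p.
  exact: (telescope_solvable telp (cotC _ (telescope_flat telp))).
(* Both decompositions identify the divisible summands with the same subgroup of [C], and the
   [p]-components with quotients by the same kernel. *)
move=> D D' Cp Cp' /decomposition_invariants[hC [i [iI iE]]].
move=> /decomposition_invariants[hC' [i' [i'I i'E]]].
split=> [|p]; first by apply: (inj_same_im_iso iI i'I) => x; rewrite iE i'E.
have [h [hS hE]] := hC p; have [h' [h'S h'E]] := hC' p.
by apply: (surj_same_ker_iso hS h'S) => x; rewrite hE h'E.
Qed.
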